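(* Let $k\ge 1$ and let $G$ be a general Martens-special discrete chain of cycles of type $k$ and genus $g$. Then its gonality sequence $(g_r(G))_{r\ge 1}$ is given by \begin{itemize} \item $g_r(G)=k+2r$ for $1\le r\le g-k-1$, \item $g_r(G)=r+g-1$ for $g-k\le r\le g-1$, \item $g_r(G)=r+g$ for $r\ge g$. \end{itemize}
   Context: Finite graphs and divisors. A finite graph $G$ consists of a finite set $V(G)$ of vertices and a finite set $E(G)$ of edges, each $e\in E(G)$ having an associated set $V(e)\subset V(G)$ of two distinct vertices (parallel edges are allowed, loops are not); $G$ is assumed connected. A divisor on $G$ is a formal combination $D=\sum_{v\in V(G)}D(v)v$ with $D(v)\in\mathbb{Z}$; its degree is $\sum_v D(v)$; it is effective if all $D(v)\ge 0$. For $f:V(G)\to\mathbb{Z}$, $\mathrm{div}(f)$ is the divisor with $\mathrm{div}(f)(v)=\sum_{e\in E(G):\,v\in V(e)}(f(v)-f(w_e))$, where $V(e)=\{v,w_e\}$. Divisors $D_1,D_2$ are linearly equivalent if $D_1-D_2=\mathrm{div}(f)$ for some $f$. The rank $\mathrm{rk}(D)$ is $-1$ if $D$ is not linearly equivalent to an effective divisor; otherwise it is the maximal integer $r\ge 0$ such that for each effective divisor $E$ of degree $r$ there is an effective divisor $D'$ linearly equivalent to $D$ with $D'-E$ effective. For $r\ge 1$, $g_r(G)$ is the minimal integer $n$ such that there is a divisor $D$ on $G$ with $\deg(D)=n$ and $\mathrm{rk}(D)\ge r$. Discrete chains of cycles. A finite cycle of size $n\ge 2$ is a finite graph with vertices $v_1,\dots,v_n$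 (in this order) and the $n$ edges $\{v_1,v_2\},\{v_2,v_3\},\dots,\{v_{n-1},v_n\},\{v_n,v_1\}$ (two parallel edges when $n=2$). A discrete chain of cycles $G$ of genus $g$ is obtained from finite cycles $G_1,\dots,G_g$ of sizes $n_1,\dots,n_g$, with $V(G_i)=\{v_{i,1},\dots,v_{i,n_i}\}$ in cyclic order, and a choice of vertices $v_{i,p_i}\ne v_{i,1}$ ($1\le i\le g$, $2\le p_i\le n_i$), by putting $V(G)=\bigcup_i V(G_i)$ and $E(G)=\bigcup_i E(G_i)\cup\{\{v_{1,p_1},v_{2,1}\},\{v_{2,p_2},v_{3,1}\},\dots,\{v_{g-1,p_{g-1}},v_{g,1}\}\}$. Its profile sequence is $\underline m=(m_2,\dots,m_g)$, where $m_i$ is the smallest positive integer such that $m_i(p_i-1)$ is an integer multiple of $n_i$. A discrete chain of cycles $G$ of genus $g$ is a general Martens-special discrete chain of cycles of type $k$ if there are integers $3\le j_1\le j_2\le\dots\le j_k\le g-2$ with $j_{i+1}-j_i\ge 2$ for $1\le i\le k-1$ such that $m_i=2$ for $i\in\{2,\dots,g-1\}\setminus\{j_1,\dots,j_k\}$ and $m_{j_i}>g$ for $1\le i\le k$. *)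

(* Defs.v *)
From HB Require Import structures.
From mathcomp Require Import all_boot all_order all_algebra.
Set Implicit Arguments.
Unset Strict Implicit.
Unset Printing Implicit Defensive.
Import Order.TTheory GRing.Theory Num.Theory.
Local Open Scope ring_scope.

Record graph := Graph {
  vertex : finType;
  edge : finType;
  ends : edge -> {set vertex};
  card_ends : forall e, #|ends e| = 2%N;
  graph_connected :
    forall x y, connect [rel a b | [exists e, ends e == [set a; b]]] x y
}.

Section Divisors.
Variable G : graph.

Definition divisor := {ffun vertex G -> int}.

Definition deg (D : divisor) : int := \sum_v D v.

Definition effective (D : divisor) : bool := [forall v, 0 <= D v].

(* When v is an end of e, the set [ends e :\ v] is the singleton of the other
   end of e, so the inner sum has exactly one term. *)
Definition div (f : {ffun vertex G -> int}) : divisor :=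
  [ffun v => \sum_(e | v \in ends e) \sum_(w in ends e :\ v) (f v - f w)].

Definition lin_equiv (D1 D2 : divisor) : Prop :=
  exists f : {ffun vertex G -> int}, D1 - D2 = div f.

Definition equiv_effective (D : divisor) : Prop :=
  exists2 D' : divisor, lin_equiv D D' & effective D'.

Definition can_subtract (D : divisor) (r : int) : Prop :=
  forall E : divisor, effective E -> deg E = r ->
  exists D' : divisor, [/\ effective D', lin_equiv D' D & effective (D' - E)].

(* [is_rank D r] means rk(D) = r. *)
Definition is_rank (D : divisor) (r : int) : Prop :=
  (~ equiv_effective D /\ r = -1) \/
  [/\ equiv_effective D, 0 <= r, can_subtract D r &
      forall s : int, 0 <= s -> can_subtract D s -> s <= r].

Definition rank_ge (D : divisor) (r : int) : Prop :=
  exists2 s : int, is_rank D s & r <= s.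

(* [is_gonality r n] means that n is the r-th term g_r(G) of the gonality
   sequence; in particular it asserts that the minimum exists. *)
Definition is_gonality (r : nat) (n : int) : Prop :=
  (exists2 D : divisor, deg D = n & rank_ge D r%:Z) /\
  (forall D : divisor, rank_ge D r%:Z -> n <= deg D).

End Divisors.

(* Indices are shifted by one: cycle number i of the chain is the ordinal of
   value i - 1, and its vertex v_{i,j} is the ordinal of value j - 1. Hence
   [attach i] has value p_i - 1. *)
Record discrete_chain (g : nat) := DiscreteChain {
  cycle_size : 'I_g -> nat;
  cycle_size_gt1 : forall i, (1 < cycle_size i)%N;
  attach : forall i, 'I_(cycle_size i);
  attach_neq0 : forall i, attach i != 0%N :> nat
}.

Section ChainGraph.
Variables (g : nat) (C : discrete_chain g).

Definition chain_vertex : finType := {i : 'I_g & 'I_(cycle_size C i)}.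

Definition cvert (i : 'I_g) (j : 'I_(cycle_size C i)) : chain_vertex :=
  Tagged (fun i => 'I_(cycle_size C i)) j.

Definition first_vertex (i : 'I_g) : 'I_(cycle_size C i) :=
  Ordinal (ltnW (cycle_size_gt1 C i)).

Definition bridge_src (b : 'I_g.-1) : 'I_g := widen_ord (leq_pred g) b.

Lemma bridge_tgt_subproof (b : 'I_g.-1) : (b.+1 < g)%N.
Proof. by rewrite -ltn_predRL. Qed.

Definition bridge_tgt (b : 'I_g.-1) : 'I_g := Ordinal (bridge_tgt_subproof b).

(* A left summand (i, j) is the j-th edge of the i-th cycle ([ordS] is the
   cyclic successor, so a cycle of size 2 has two parallel edges); a right
   summand b is the edge joining cycle b to cycle b + 1. *)
Definition chain_edge : finType :=
  ({i : 'I_g & 'I_(cycle_size C i)} + 'I_g.-1)%type.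

Definition chain_ends (e : chain_edge) : {set chain_vertex} :=
  match e with
  | inl u => [set cvert (tagged u); cvert (ordS (tagged u))]
  | inr b => [set cvert (attach C (bridge_src b));
                  cvert (first_vertex (bridge_tgt b))]
  end.

Lemma card_chain_ends (e : chain_edge) : #|chain_ends e| = 2%N.
Proof.
case: e => [[i j]|b]; rewrite /chain_ends cards2; last first.
  case: eqP => // /(congr1 (fun x : chain_vertex => val (tag x))) /= /eqP.
  by rewrite ltn_eqF.
have n1 := cycle_size_gt1 C i.
case: eqP => // /eqP; rewrite eq_Tagged => /eqP /(congr1 val) /= E.
have := ltn_ord j; rewrite leq_eqVlt => /orP[/eqP Ej|ltj].
  by move: E; rewrite Ej modnn => E0; rewrite -Ej E0 in n1.
by move: E; rewrite modn_small // => /eqP; rewrite ltn_eqF.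
Qed.

Let adj : rel chain_vertex :=
  [rel a b | [exists e, chain_ends e == [set a; b]]].

Lemma chain_connected (x y : chain_vertex) : connect adj x y.
Proof.
have adjS : symmetric adj.
  by move=> a b; apply: eq_existsb => e; rewrite setUC.
have connS := sym_connect_sym adjS.
have in_cycle i (j : 'I_(cycle_size C i)) :
    connect adj (cvert (first_vertex i)) (cvert j).
  case: j => m; elim: m => [|m IHm] lt_m.
    by rewrite (_ : Ordinal lt_m = first_vertex i) //; apply: val_inj.
  apply: connect_trans (IHm (ltnW lt_m)) (connect1 _).
  apply/existsP; exists (inl (cvert (Ordinal (ltnW lt_m)))).
  rewrite /chain_ends /=; apply/eqP; congr [set _; cvert _].
  by apply: val_inj; rewrite /= modn_small.
have along (i i' : 'I_g) : (i <= i')%N ->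
    connect adj (cvert (first_vertex i)) (cvert (first_vertex i')).
  case: i' => m; elim: m => [|m IHm] lt_m /=.
    rewrite leqn0 => /eqP i0.
    by rewrite (_ : Ordinal lt_m = i) //; apply: val_inj; rewrite /= i0.
  rewrite leq_eqVlt => /orP[/eqP im|].
    by rewrite (_ : Ordinal lt_m = i) //; apply: val_inj; rewrite /= im.
  rewrite ltnS => le_im; apply: connect_trans (IHm (ltnW lt_m) le_im) _.
  have lt_b : (m < g.-1)%N by rewrite ltn_predRL.
  pose b := Ordinal lt_b.
  have -> : Ordinal (ltnW lt_m) = bridge_src b by apply: val_inj.
  have -> : Ordinal lt_m = bridge_tgt b by apply: val_inj.
  apply: connect_trans (in_cycle _ (attach C (bridge_src b))) (connect1 _).
  by apply/existsP; exists (inr b).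
case: x y => [i j] [i' j'].
apply: (@connect_trans _ _ (cvert (first_vertex i))).
  by rewrite connS; apply: in_cycle.
apply: connect_trans (in_cycle i' j').
by case/orP: (leq_total i i') => /along //; rewrite connS.
Qed.

Definition chain_graph : graph := Graph card_chain_ends chain_connected.

Lemma profile_subproof (i : 'I_g) :
  exists m, (0 < m)%N && (cycle_size C i %| m * attach C i)%N.
Proof.
by exists (cycle_size C i); rewrite dvdn_mulr // ltnW // cycle_size_gt1.
Qed.

(* m_{i+1}, the least m > 0 such that m (p_{i+1} - 1) is a multiple of
   n_{i+1}. It is also defined for the first cycle, where it plays no role. *)
Definition profile (i : 'I_g) : nat := ex_minn (profile_subproof i).

(* The entries of j are the 1-based indices j_1, ..., j_k, whence the
   comparisons with [i.+1]. *)
Definition general_martens_special (k : nat) : Prop :=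
  exists j : k.-tuple nat,
    [/\ all (fun a => 3 <= a <= g - 2)%N j,
        sorted (fun a b => a + 2 <= b)%N j,
        forall i : 'I_g, (2 <= i.+1 <= g - 1)%N -> i.+1 \notin j ->
          profile i = 2%N &
        forall i : 'I_g, i.+1 \in j -> (g < profile i)%N].

End ChainGraph.

(* Main.v *)
(** A class of divisors on a chain of cycles is determined by its degree and,
    for each cycle i, by a residue modulo n_i: the sum of the positions of the
    chips after retracting the graph onto cycle i. Push all chips to the
    right. When k chips arrive at cycle i, they all move on if the residue is
    k (p_i - 1), in which case the cycle is called lucky; otherwise one of them
    must stay behind. The divisor is equivalent to an effective one if and
    only if the number of chips that reach the end is nonnegative.

    Upper bounds: choose the residues so that the cycles that are not special
    are lucky, in an order that fills the antidiagonals of an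
    (r + 1) x (g - k - r) rectangle.

    Lower bounds: if D has rank at least r and degree d, subtract u chips in
    the course of the walk and r - u at its end, for 0 <= u <= r. The numbers
    of lucky cycles met by these r + 1 walks are the row lengths of a growing
    partition that contains an (r + 1) x (g - d + r) rectangle at the end.
    At each cycle the new cells have contents that agree modulo m_i, so that
    they share a parity if m_i = 2, while a special cycle adds at most one cell
    of the rectangle. Since two special cycles are never adjacent, filling an
    a x b rectangle with a, b >= 2 takes a + b - 1 cycles that are not
    special, and only g - k of them are available. *)

Require Import Defs.
From HB Require Import structures.
From mathcomp Require Import all_boot all_order all_algebra.
From mathcomp Require Import zify.
From mathcomp Require Import boolp.
Set Implicit Arguments.
Unset Strict Implicit.
Unset Printing Implicit Defensive.
Import Order.TTheory GRing.Theory Num.Theory.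

(** * A growth bound for restricted fillings of a rectangle *)

Lemma ltn_sum_antitone (A : pred nat) (n u : nat) :
    (forall v w, v <= w -> A w -> A v) -> u < n ->
  (u < \sum_(v < n) A v) = A u.
Proof.
move=> Adown; elim: n => // n IHn; rewrite big_ord_recr /= ltnS => le_un.
have le_sum : \sum_(v < n) A v <= n.
  by rewrite -[leqRHS]card_ord -sum1_card leq_sum // => v _; case: (A v).
have [An|nAn] := boolP (A n); last first.
  rewrite addn0; move: le_un; rewrite leq_eqVlt => /predU1P[->|/IHn //].
  by rewrite (negbTE nAn) ltnNge le_sum.
rewrite (Adown _ _ le_un An) (eq_bigr (fun=> 1)) => [|v _].
  by rewrite sum1_card card_ord addn1 ltnS.
by rewrite (Adown v n (ltnW (ltn_ord v)) An).
Qed.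

Section TwoTracks.
Variable s : pred nat.
Hypothesis s_sparse : forall i, s i -> ~~ s i.+1.

Definition regular_before (i : nat) : nat := count (predC s) (iota 0 i).

Lemma regular_beforeS i : regular_before i.+1 = regular_before i + ~~ s i.
Proof. by rewrite /regular_before -addn1 iotaD count_cat /= add0n addn0. Qed.

(** [p] and [q] stand for the lengths of two adjacent rows, or columns, of the growing shape. The
    contents of their next cells differ by [p - q + 1] up to sign, so they share a parity exactly
    when [p + q] is odd. *)
Definition track_step (i p q p' q' : nat) : Prop :=
  [/\ p <= p' <= p.+1, q <= q' <= q.+1, q < q' -> q < p &
      p < p' -> q < q' -> ~~ s i && odd (p + q)].

(* At an even value of [p + q] two regular steps are needed to gain one cell in
   each track, hence the correction term. *)
Definition track_potential (p q : nat) : nat := p + q + ~~ odd (p + q).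

(* Each regular step raises the potential by at most 2. A special step may do so
   too, but it then leaves [p + q] even, and the next step, which is regular,
   does not raise it: the last summand on the right is this debt. *)
Lemma track_potential_bound (p q : nat -> nat) (i0 i1 K L : nat) :
    (forall i, i0 <= i < i1 -> track_step i (p i) (q i) (p i.+1) (q i.+1)) ->
    track_potential (p i0) (q i0) + L <=
      2 * regular_before i0 + K +
      2 * [&& 0 < i0, s i0.-1 & ~~ odd (p i0 + q i0)] ->
  forall i, i0 <= i <= i1 ->
    track_potential (p i) (q i) + L <=
      2 * regular_before i + K +
      2 * [&& 0 < i, s i.-1 & ~~ odd (p i + q i)].
Proof.
move=> step base i /andP[]; elim: i => [|i IHi].
  by rewrite leqn0 => /eqP i00 _; move: base; rewrite i00.
rewrite leq_eqVlt => /predU1P[<- _ //|]; rewrite ltnS => le_i0 lt_i1.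
have {IHi} IH := IHi le_i0 (ltnW lt_i1).
have [] := step i; first by rewrite le_i0.
rewrite /track_potential regular_beforeS /= in IH *.
(* Special steps are never consecutive, so no debt is pending when one begins. *)
have s_prev : s i -> [&& 0 < i, s i.-1 & ~~ odd (p i + q i)] = false.
  case: (i) => // j /= sj1; case sj: (s j) => //.
  by have := s_sparse sj; rewrite sj1.
have [si|_] /= := boolP (s i).
  by move: IH; rewrite s_prev // => IH P Q _ PQ; lia.
by move: IH; case: (0 < i) => /=; case: (s i.-1) => /= IH P Q QP PQ; lia.
Qed.


(* The two-track bound is applied to the first two columns until the last but one
   row reaches length 2, and from then on to the last two rows. At the switch
   both pairs of tracks give the same bound. *)
Lemma growth_bound (P : nat -> nat -> nat) (g r b : nat) :
    0 < r -> 1 < b -> ~~ s 0 -> ~~ s g.-1 ->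
    (forall u, P 0 u = 0) ->
    (forall u, u <= r -> P g u = b) ->
    (forall i u, P i u <= P i.+1 u <= (P i u).+1) ->
    (forall i u, P i u.+1 < P i.+1 u.+1 -> P i u.+1 < P i u) ->
    (forall i u v, 0 < i < g.-1 -> ~~ s i -> u <= r -> v <= r ->
       P i u < P i.+1 u -> P i v < P i.+1 v -> odd (u + P i u) = odd (v + P i v)) ->
    (forall i u v, i < g -> s i -> u <= r -> v <= r ->
       P i u < P i.+1 u -> P i v < P i.+1 v -> u = v) ->
  r + b <= regular_before g.
Proof.
move=> r0 b1 ns0 nsl P0 Pg Pstep Ppart Preg Pspec.
have PS i u : P i.+1 u <= (P i u).+1 by case/andP: (Pstep i u).
have Ple i u : P i u <= P i.+1 u by case/andP: (Pstep i u).
have Pmono i u v : u <= v -> P i v <= P i u.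
  move=> /subnKC<-; elim: (v - u) => [|w IHw]; first by rewrite addn0.
  rewrite addnS (leq_trans _ IHw) //; elim: (i) => [|j IHj]; first by rewrite !P0.
  have := Ple j (u + w); have := PS j (u + w).+1; have := Ppart j (u + w); lia.
(* Parity extends to the two end cycles, where at most one row grows: row 0 at the first, because
   the shape is empty, and row [r] at the last, because the final shape is a rectangle. *)
have {}Preg i u v : i < g -> ~~ s i -> u <= r -> v <= r ->
    P i u < P i.+1 u -> P i v < P i.+1 v -> odd (u + P i u) = odd (v + P i v).
  move=> lt_ig nsi le_ur le_vr mu mv.
  have [i0|i0] := posnP i.
    have first w : P i w < P i.+1 w -> w = 0.
      by case: w => // w /Ppart; rewrite i0 !P0.
    by rewrite (first u mu) (first v mv).
  have [lt_ig1|] := ltnP i g.-1; first by apply: Preg; rewrite ?i0.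
  move=> le_gi; have gE : g = i.+1 by lia.
  have last w : w <= r -> P i w < P i.+1 w -> w = r.
    move=> le_wr mw; apply/eqP; rewrite eqn_leq le_wr leqNgt; apply/negP => lt_wr.
    have := Pg w.+1 lt_wr; have := Pg w le_wr; rewrite gE.
    have := Ppart i w; have := Pmono i w w.+1 (leqnSn w); have := PS i w.+1.
    have := PS i w; lia.
  by rewrite (last u le_ur mu) (last v le_vr mv).
(* The length of column [c] after [i] steps, counted within rows 0 to [r]. *)
pose q c i := \sum_(u < r.+1) (c < P i u).
have qP c i u : u <= r -> (u < q c i) = (c < P i u).
  move=> le_ur; rewrite /q (ltn_sum_antitone (A := fun v => c < P i v)) //.
  by move=> v w /(Pmono i)/[swap]; apply: leq_trans.
have q_le c i : q c i <= r.+1.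
  by rewrite -[leqRHS]card_ord -sum1_card leq_sum // => v _; case: (_ < _).
have q_step i : i < g -> track_step i (q 0 i) (q 1 i) (q 0 i.+1) (q 1 i.+1).
  move=> lt_ig.
  have bounds c : q c i <= q c i.+1 <= (q c i).+1.
    apply/andP; split; rewrite leqNgt; apply/negP => lt_q.
      have le_r : q c i.+1 <= r by have := q_le c i; lia.
      have := qP c i _ le_r; have := qP c i.+1 _ le_r.
      by have := Ple i (q c i.+1); rewrite lt_q ltnn; lia.
    have le_r : (q c i).+1 <= r by have := q_le c i.+1; lia.
    have := qP c i.+1 _ le_r; have := qP c i _ (ltnW le_r).
    have := Ppart i (q c i); have := PS i (q c i).+1.
    by have := Pmono i _ _ (leqnSn (q c i)); rewrite lt_q ltnn; lia.
  have move_q c : q c i < q c i.+1 ->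
      [/\ q c i <= r, P i (q c i) = c & P i (q c i) < P i.+1 (q c i)].
    move=> lt_q; have le_r : q c i <= r by have := q_le c i.+1; lia.
    have := qP c i.+1 _ le_r; have := qP c i _ le_r; rewrite lt_q ltnn.
    by have := PS i (q c i); split=> //; lia.
  split=> // [/move_q[le_r E _]|/move_q[le_r E m] /move_q[le_r' E' m']].
    by rewrite qP // E.
  have [si|nsi] /= := boolP (s i).
    by have qE := Pspec _ _ _ lt_ig si le_r le_r' m m'; move: E; rewrite qE E'.
  have := Preg _ _ _ lt_ig nsi le_r le_r' m m'; rewrite E E'; lia.
have [x rE] : exists x, r = x.+1 by exists r.-1; lia.
have exT : exists i, 1 < P i x by exists g; rewrite Pg //; lia.
case: (ex_minnP exT) => T PT minT.
have T0 : 0 < T by case: (T) PT => //; rewrite P0.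
have le_Tg : T <= g by apply: minT; rewrite Pg //; lia.
have PT1 : P T.-1 x <= 1 by rewrite leqNgt; apply/negP => /minT; lia.
have [PTx PTr] : P T x = 2 /\ P T r <= 1.
  have := PS T.-1 x; have := PS T.-1 r; have := Ppart T.-1 x.
  have := Pmono T.-1 _ _ (leqnSn x); rewrite -rE prednK //; lia.
have q0T : q 0 T = r + (0 < P T r).
  have := qP 0 T _ (leqnn r); have := qP 0 T x; have := q_le 0 T.
  by rewrite PTx; lia.
have q1T : q 1 T = r.
  by have := qP 1 T _ (leqnn r); have := qP 1 T x; rewrite PTx; lia.
have n1 : regular_before 1 = 1 by rewrite regular_beforeS ns0.
(* Starting after step 0 gains the offset 1: that step is regular and adds at most the corner cell,
   so the potential is still 1. *)
have col : track_potential (q 0 T) (q 1 T) + 1 <=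
    2 * regular_before T + 0 + 2 * [&& 0 < T, s T.-1 & ~~ odd (q 0 T + q 1 T)].
  apply: (@track_potential_bound (q 0) (q 1) 1 g); last by rewrite T0.
    by move=> i /andP[_]; apply: q_step.
  have q11 : q 1 1 = 0.
    by have := qP 1 1 0 isT; have := PS 0 0; rewrite P0; lia.
  have q01 : q 0 1 <= 1.
    have := qP 0 1 1 r0; have := Ppart 0 0; rewrite !P0; lia.
  rewrite n1 q11 /track_potential; lia.
(* At time [T] the potential is [2 * r + 1] for the columns and 3 for the rows, whence the offset
   [2 * r - 1]; the two debts agree as well. *)
have row : track_potential (P g x) (P g r) + (2 * r - 1) <=
    2 * regular_before g + 0 + 2 * [&& 0 < g, s g.-1 & ~~ odd (P g x + P g r)].
  apply: (@track_potential_bound (P^~ x) (P^~ r) T g); last by rewrite le_Tg leqnn.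
    move=> i /andP[_ lt_ig]; split=> // [|mx mr]; first by rewrite rE; apply: Ppart.
    have le_xr : x <= r by rewrite rE.
    have [si|nsi] /= := boolP (s i).
      by have := Pspec _ _ _ lt_ig si le_xr (leqnn r) mx mr; lia.
    have := Preg _ _ _ lt_ig nsi le_xr (leqnn r) mx mr; rewrite rE; lia.
  move: col; rewrite q0T q1T PTx /track_potential.
  by case: (P T r) PTr => [|[|]] //; rewrite T0 /=; case: (s T.-1); lia.
move: row; rewrite (negbTE nsl) andbF /track_potential !Pg //; last by lia.
lia.
Qed.

End TwoTracks.

Local Open Scope ring_scope.

(** * Divisors and rank on a finite graph *)

Section GraphDivisors.
Variable G : graph.
Implicit Types (D E : divisor G) (f : {ffun vertex G -> int}) (v : vertex G).

Fact div_is_additive : zmod_morphism (@div G).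
Proof.
have subACA (a b c d : int) : a - b - (c - d) = a - c - (b - d) by lia.
move=> f f'; apply/ffunP => v; rewrite !ffunE -sumrB; apply: eq_bigr => e _.
by rewrite -sumrB; apply: eq_bigr => w _; rewrite !ffunE subACA.
Qed.

HB.instance Definition _ := GRing.isZmodMorphism.Build _ _ (@div G) div_is_additive.

Lemma divD f f' : div (f + f') = div f + div f'. Proof. exact: raddfD. Qed.

Lemma divMz f (n : int) : div (f *~ n) = div f *~ n. Proof. exact: raddfMz. Qed.

Lemma lin_equiv_sym D E : lin_equiv D E -> lin_equiv E D.
Proof. by case=> f Ef; exists (- f); rewrite raddfN /= -Ef opprB. Qed.

Lemma lin_equiv_refl D : lin_equiv D D.
Proof. by exists 0; rewrite subrr raddf0. Qed.

Lemma lin_equiv_trans D E F : lin_equiv D E -> lin_equiv E F -> lin_equiv D F.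
Proof.
by case=> f Df [f' Ef]; exists (f + f'); rewrite divD -Df -Ef addrA subrK.
Qed.

Lemma lin_equivD D D' E E' :
  lin_equiv D D' -> lin_equiv E E' -> lin_equiv (D + E) (D' + E').
Proof.
case=> f Df [f' Ef]; exists (f + f').
by rewrite divD -Df -Ef opprD addrACA.
Qed.

Lemma lin_equivMz D E (n : int) : lin_equiv D E -> lin_equiv (D *~ n) (E *~ n).
Proof. by case=> f Df; exists (f *~ n); rewrite divMz -Df mulrzBl. Qed.

Lemma lin_equiv_sum (I : finType) (F F' : I -> divisor G) :
  (forall i, lin_equiv (F i) (F' i)) -> lin_equiv (\sum_i F i) (\sum_i F' i).
Proof.
move=> FF'; apply: (big_ind2 (@lin_equiv G)) => // [|D D' E E'].
  exact: lin_equiv_refl.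
exact: lin_equivD.
Qed.

Lemma lin_equiv_subr D D' E : lin_equiv D D' -> lin_equiv (D - E) (D' - E).
Proof. by case=> f Ef; exists f; rewrite opprB addrA subrK. Qed.

Fact deg_is_additive : zmod_morphism (@deg G).
Proof. by move=> D E; rewrite /deg -sumrB; apply: eq_bigr => v _; rewrite !ffunE. Qed.

HB.instance Definition _ := GRing.isZmodMorphism.Build _ _ (@deg G) deg_is_additive.

Lemma effectiveD D E : effective D -> effective E -> effective (D + E).
Proof.
by move=> /forallP D0 /forallP E0; apply/forallP => v; rewrite ffunE addr_ge0.
Qed.

Lemma deg_effective D : effective D -> 0 <= deg D.
Proof. by move=> /forallP D0; apply: sumr_ge0 => v _. Qed.

Definition chip v : divisor G := [ffun w => (w == v)%:Z].

Lemma deg_chip v : deg (chip v) = 1.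
Proof.
rewrite /deg (bigD1 v) //= ffunE eqxx big1 ?addr0 // => w /negbTE nwv.
by rewrite ffunE nwv.
Qed.

Lemma degB D E : deg (D - E) = deg D - deg E. Proof. exact: raddfB. Qed.

Lemma degD D E : deg (D + E) = deg D + deg E. Proof. exact: raddfD. Qed.

Lemma deg_chips v n : deg (chip v *+ n) = n%:Z.
Proof. by rewrite raddfMn /= deg_chip natz. Qed.

Lemma effective_chips v n : effective (chip v *+ n).
Proof.
elim: n => [|n IHn]; first by apply/forallP => w; rewrite mulr0n ffunE.
by rewrite mulrS effectiveD //; apply/forallP => w; rewrite ffunE.
Qed.

Lemma sum_mul_chip (phi : vertex G -> int) v :
  \sum_w phi w * chip v w = phi v.
Proof.
rewrite (bigD1 v) //= ffunE eqxx mulr1 big1 ?addr0 // => w /negbTE nwv.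
by rewrite ffunE nwv mulr0.
Qed.


Lemma chip_decomposition D : D = \sum_v chip v *~ D v.
Proof.
apply/ffunP => w; rewrite sum_ffunE -[LHS](sum_mul_chip D); apply: eq_bigr => v _.
by rewrite ffunMzE !ffunE eq_sym mulrzz mulrC.
Qed.

Lemma sum_edge_ends (x y : vertex G) (F : vertex G -> vertex G -> int) :
    x != y ->
  \sum_(v in [set x; y]) \sum_(w in [set x; y] :\ v) F v w = F x y + F y x.
Proof.
move=> nxy; rewrite big_setU1 ?inE //= big_set1.
by rewrite setU1K ?inE // setUC setU1K ?inE 1?eq_sym // !big_set1.
Qed.

Lemma sum_mul_div (phi : vertex G -> int) f :
  \sum_v phi v * div f v =
  \sum_e \sum_(v in ends e) \sum_(w in ends e :\ v) phi v * (f v - f w).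
Proof.
under eq_bigr do rewrite ffunE mulr_sumr.
rewrite (exchange_big_dep predT) //=; apply: eq_bigr => e _.
by apply: eq_bigr => v _; rewrite mulr_sumr.
Qed.

Lemma deg_div f : deg (div f) = 0.
Proof.
rewrite /deg; under eq_bigr do rewrite -[div f _]mul1r.
rewrite (sum_mul_div (fun=> 1)) big1 // => e _.
have /eqP/cards2P[x [y [nxy ->]]] := card_ends e.
by rewrite sum_edge_ends // !mul1r; lia.
Qed.

Lemma lin_equiv_deg D E : lin_equiv D E -> deg D = deg E.
Proof. by case=> f /(congr1 (@deg G)); rewrite raddfB deg_div => /subr0_eq. Qed.

(** The vertex [v] certifies that the graph is nonempty. On the empty graph [can_subtract] holds
    vacuously for every positive [r], and no maximum exists. *)
Lemma can_subtract_le_deg D (r : int) v :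
  0 <= r -> can_subtract D r -> r <= deg D.
Proof.
case: r => // n _ /(_ (chip v *+ n)) [||D' [_ /lin_equiv_deg <- /deg_effective]].
- exact: effective_chips.
- by rewrite deg_chips.
by rewrite degB deg_chips subr_ge0.
Qed.

Lemma can_subtract_trans D (r s : int) v :
  0 <= r <= s -> can_subtract D s -> can_subtract D r.
Proof.
case/andP=> r0 le_rs canD E effE degE.
have [||D' [eff' equiv' effD']] := canD (E + chip v *+ `|s - r|%N).
- by rewrite effectiveD ?effective_chips.
- by rewrite degD deg_chips degE; lia.
exists D'; split=> //; rewrite -[E](addrK (chip v *+ `|s - r|%N)) opprB addrCA.
by rewrite effectiveD ?effective_chips.
Qed.


Lemma can_subtract_chips D (r n : nat) v :
  can_subtract D (r + n)%N%:Z -> can_subtract (D - chip v *+ n) r%:Z.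
Proof.
move=> canD E effE degE; have [||D' [_ DD' effD']] := canD (E + chip v *+ n).
- by rewrite effectiveD ?effective_chips.
- by rewrite degD deg_chips degE PoszD.
have D'E : D' - chip v *+ n = D' - (E + chip v *+ n) + E.
  by rewrite opprD addrA addrAC subrK.
exists (D' - chip v *+ n); split; last by rewrite D'E addrK.
  by rewrite D'E effectiveD.
exact: lin_equiv_subr.
Qed.

Lemma rank_geP D (r : nat) v : rank_ge D r%:Z <-> can_subtract D r%:Z.
Proof.
split=> [[s [[_ ->]|[_ s0 canD _]]] // le_rs|canD].
  by apply: (can_subtract_trans v) canD; rewrite le_rs.
have ex_s : exists s : nat, `[< can_subtract D s%:Z >] by exists r; apply/asboolP.
have ub_s s : `[< can_subtract D s%:Z >] -> (s <= `|deg D|)%N.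
  by move=> /asboolP /(can_subtract_le_deg v (isT : 0 <= s%:Z)); lia.
case: (ex_maxnP ex_s ub_s) => s /asboolP canDs max_s.
exists s%:Z; last by rewrite lez_nat max_s //; apply/asboolP.
right; split=> // [|[] // t _ /asboolP/max_s //].
have [||D' [effD' /lin_equiv_sym equivD' _]] := canD (chip v *+ r).
- exact: effective_chips.
- by rewrite deg_chips.
by exists D'.
Qed.

End GraphDivisors.

(** * Linear equivalence on a chain of cycles *)

Canonical chain_graph.

Section ChainClass.
Variables (g : nat) (C : discrete_chain g.+1).
Notation V := (chain_vertex C).
Notation G := (chain_graph C).
Notation size := (cycle_size C).
Implicit Types (i l : 'I_g.+1) (v : V) (D E : divisor G) (f : {ffun V -> int}).

(* The position on cycle [i] of the retraction of [v] onto that cycle. *)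
Definition pos i v : nat :=
  if (tag v < i)%N then 0%N else 
  if tag v == i then nat_of_ord (tagged v) else nat_of_ord (attach C i).

Definition moment i D : int := \sum_v D v * (pos i v)%:Z.

Fact moment_is_additive i : zmod_morphism (moment i).
Proof.
move=> D E; rewrite /moment -sumrB; apply: eq_bigr => v _.
by rewrite !ffunE mulrBl.
Qed.

HB.instance Definition _ i :=
  GRing.isZmodMorphism.Build _ _ (moment i) (moment_is_additive i).

Lemma moment_chip i v : moment i (chip v) = (pos i v)%:Z.
Proof.
rewrite /moment; under eq_bigr do rewrite mulrC.
exact: (sum_mul_chip (fun v => (pos i v)%:Z)).
Qed.

Lemma momentB i D E : moment i (D - E) = moment i D - moment i E.
Proof. exact: raddfB. Qed.

Lemma momentD i D E : moment i (D + E) = moment i D + moment i E.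
Proof. exact: raddfD. Qed.

Lemma moment_chips i v n : moment i (chip v *+ n) = n%:Z * (pos i v)%:Z.
Proof. by rewrite raddfMn /= moment_chip -mulr_natl natz. Qed.

Lemma pos_tag i (j : 'I_(size i)) : pos i (cvert j) = j.
Proof. by rewrite /pos /= ltnn eqxx. Qed.

Lemma pos_lt i v : (tag v < i)%N -> pos i v = 0.
Proof. by rewrite /pos => ->. Qed.

Lemma pos_gt i v : (i < tag v)%N -> pos i v = attach C i.
Proof.
by rewrite /pos => lt_iv; rewrite ltnNge ltnW //= gt_eqF // -val_eqE /=.
Qed.

Lemma pos_same_cycle i l (j j' : 'I_(size l)) :
  l != i -> pos i (cvert j) = pos i (cvert j').
Proof. by rewrite /pos /= => /negbTE ->. Qed.

Lemma pos_bridge i (b : 'I_g.+1.-1) :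
  pos i (cvert (attach C (bridge_src b))) =
  pos i (cvert (first_vertex C (bridge_tgt b))).
Proof.
case: (ltngtP b i) => [lt_bi|lt_ib|/= bi].
- rewrite pos_lt //; move: lt_bi; rewrite leq_eqVlt => /predU1P[bi|lt_bi].
    have <- : bridge_tgt b = i by apply: val_inj.
    by rewrite pos_tag.
  by rewrite pos_lt.
- by rewrite !pos_gt //= ltnW.
have <- : bridge_src b = i by apply: val_inj.
by rewrite pos_tag pos_gt.
Qed.

Definition edge_sum (F : V -> V -> int) : int :=
  \sum_i \sum_(j : 'I_(size i)) F (cvert j) (cvert (ordS j)) +
  \sum_(b < g.+1.-1) F (cvert (attach C (bridge_src b)))
                 (cvert (first_vertex C (bridge_tgt b))).

(** Summation by parts over the edges. With [phi] a position it computes moments of [div f], with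
    [phi] a chip it computes values of [div f]. *)
Lemma green (phi : V -> int) f :
  \sum_v phi v * (div (f : {ffun vertex G -> int})) v =
  edge_sum (fun v w => (phi v - phi w) * (f v - f w)).
Proof.
rewrite (@sum_mul_div G) /edge_sum.
have edgeE (e : edge G) x y : ends e = [set x; y] ->
  \sum_(v in ends e) \sum_(w in ends e :\ v) phi v * (f v - f w) =
  (phi x - phi y) * (f x - f y).
  move=> Ee; have := card_ends e; rewrite Ee cards2; case: eqP => // /eqP nxy _.
  by rewrite sum_edge_ends //; lia.
rewrite big_sumType /=; congr (_ + _); last first.
  by apply: eq_bigr => b _; apply: (edgeE (inr b)).
rewrite (sig_big_dep _ (fun i => predT)) /=.
by apply: eq_bigr => u _; apply: (edgeE (inl u)).
Qed.

Lemma sum_ordS n (M : zmodType) (F : 'I_n -> M) : \sum_j (F j - F (ordS j)) = 0.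
Proof. by rewrite sumrB (reindex_inj (@ordS_inj n)) /= subrr. Qed.

(** Only the edges of cycle [i] change [pos i]: by 1 along each edge, except for the closing edge,
    where it drops by [size i - 1]. Adding the vanishing cyclic sum of the differences of [f]
    cancels every term but the closing one, which becomes a multiple of [size i]. *)
Lemma moment_div i f : (size i %| moment i (div (f : {ffun vertex G -> int})))%Z.
Proof.
rewrite /moment; under eq_bigr do rewrite mulrC.
rewrite (green (fun v => (pos i v)%:Z)) /edge_sum [X in _ + X]big1 ?addr0; last first.
  by move=> b _; rewrite pos_bridge subrr mul0r.
rewrite (bigD1 i) //= [X in _ + X]big1 ?addr0; last first.
  move=> l nli; rewrite big1 // => j _.
  by rewrite (pos_same_cycle (ordS j) j) // subrr mul0r.
rewrite -[X in (_ %| X)%Z]addr0.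
rewrite -[X in (_ %| _ + X)%Z](sum_ordS (fun j : 'I_(size i) => f (cvert j))).
rewrite -big_split /=.
apply: (big_ind (fun x => (size i %| x)%Z)) => [|x y|j _].
- exact: dvdz0.
- exact: rpredD.
rewrite !pos_tag /=; set y := f _ - f _.
have lt_j := ltn_ord j; move: (lt_j); rewrite leq_eqVlt => /predU1P[jE|lt_j1].
  rewrite jE modnn subr0 -[X in _ + X]mul1r -mulrDl.
  by rewrite dvdz_mulr // (_ : _ + 1 = (size i)%:Z) ?dvdzz; lia.
rewrite modn_small //.
have -> : (j%:Z - j.+1%:Z) * y + y = 0 by lia.
exact: dvdz0.
Qed.

Lemma lin_equiv_moment i D E :
  lin_equiv D E -> (size i %| moment i D - moment i E)%Z.
Proof. by case=> f DE; rewrite -raddfB DE moment_div. Qed.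

Lemma div_at f v :
  div (f : {ffun vertex G -> int}) v =
  edge_sum (fun x y => (chip v x - chip v y) * (f x - f y)).
Proof.
rewrite -(green (chip v)) -[LHS](sum_mul_chip (div (f : {ffun vertex G -> int}))).
by apply: eq_bigr => w _; rewrite mulrC !ffunE eq_sym.
Qed.

(** * Generators and classification of the divisor classes *)

Lemma lin_equiv_bridge (b : 'I_g.+1.-1) :
  lin_equiv (chip (cvert (attach C (bridge_src b))))
            (chip (cvert (first_vertex C (bridge_tgt b)))).
Proof.
(* Bridge [b] is the only edge across which this indicator changes. *)
exists [ffun v : V => (tag v <= b)%N%:Z]; apply/ffunP => v; rewrite div_at /edge_sum.
rewrite [X in _ = X + _]big1 ?add0r => [|i _]; last first.
  by rewrite big1 // => j _; rewrite !ffunE /= subrr mulr0.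
rewrite (bigD1 b) //= big1 ?addr0 => [|b' nb]; rewrite !ffunE /=.
  by rewrite leqnn ltnn subr0 mulr1 ![v == _]eq_sym.
have -> : (b'.+1 <= b)%N = (b' <= b)%N by rewrite ltn_neqAle val_eqE nb.
by rewrite subrr mulr0.
Qed.

Definition rotation i : divisor G :=
  chip (cvert (ordS (first_vertex C i))) - chip (cvert (first_vertex C i)).

Lemma lin_equiv_rotation i (j : 'I_(size i)) :
  lin_equiv (chip (cvert (ordS j))) (chip (cvert j) + rotation i).
Proof.
(* Being a function of the retraction onto cycle [i], this can only change across edges 0 and [j] of
   that cycle. *)
exists [ffun v : V => - (0 < pos i v <= j)%N%:Z]; apply/ffunP => v.
rewrite div_at /edge_sum [X in _ = _ + X]big1 ?addr0 => [|b _]; last first.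
  by rewrite !ffunE pos_bridge subrr mulr0.
rewrite (bigD1 i) //= [X in _ = _ + X]big1 ?addr0 => [|l nli]; last first.
  rewrite big1 // => j' _.
  by rewrite !ffunE (pos_same_cycle (ordS j') j') // subrr mulr0.
have n1 := cycle_size_gt1 C i; have lt_j := ltn_ord j.
transitivity (\sum_(k : 'I_(size i)) ((k == first_vertex C i)%:Z - (k == j)%:Z) *
    (chip v (cvert k) - chip v (cvert (ordS k)))).
  under eq_bigr do rewrite mulrBl.
  have sumE k0 (F : 'I_(size i) -> int) : \sum_k (k == k0)%:Z * F k = F k0.
    by rewrite (bigD1 k0) //= eqxx mul1r big1 ?addr0 // => k /negbTE ->; rewrite mul0r.
  by rewrite sumrB !sumE /rotation !ffunE ![v == _]eq_sym; lia.
apply: eq_bigr => k _; rewrite mulrC; congr (_ * _).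
rewrite !ffunE !pos_tag -!val_eqE /=.
have lt_k := ltn_ord k; move: (lt_k); rewrite leq_eqVlt => /predU1P[kE|lt_k1].
  by rewrite kE modnn; lia.
by rewrite modn_small //; lia.
Qed.

Definition base_chip : divisor G := chip (cvert (first_vertex C ord0)).

Definition standard_class (xi : 'I_g.+1 -> int) : divisor G :=
  \sum_i rotation i *~ xi i.

Lemma pos_base i : pos i (cvert (first_vertex C ord0)) = 0%N.
Proof.
have [->|ni] := eqVneq i ord0; first by rewrite pos_tag.
by rewrite pos_lt //= lt0n.
Qed.

(** Move a chip from the base vertex to [v]: each step on a cycle adds its rotation, and each bridge
    preserves the class. *)
Lemma chip_class v :
  lin_equiv (chip v) (base_chip + standard_class (fun i => (pos i v)%:Z)).
Proof.
pose cls v := base_chip + standard_class (fun i => (pos i v)%:Z).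
have cls_rot i (j : 'I_(size i)) : (j.+1 < size i)%N ->
    cls (cvert (ordS j)) = cls (cvert j) + rotation i.
  move=> lt_j; rewrite /cls /standard_class -addrA; congr (_ + _).
  rewrite (bigD1 i) //= [in RHS](bigD1 i) //= !pos_tag /= modn_small //.
  rewrite [RHS]addrAC; congr (_ + _); first by rewrite -[j.+1]addn1 PoszD mulrzDr mulr1z.
  by apply: eq_bigr => l nli; rewrite (pos_same_cycle (ordS j) j) // eq_sym.
have in_cycle i (j : 'I_(size i)) :
    lin_equiv (chip (cvert (first_vertex C i))) (cls (cvert (first_vertex C i))) ->
  lin_equiv (chip (cvert j)) (cls (cvert j)).
  move=> first_i; case: j => m; elim: m => [|m IHm] lt_m.
    by rewrite (_ : Ordinal lt_m = first_vertex C i) //; apply: val_inj.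
  have -> : Ordinal lt_m = ordS (Ordinal (ltnW lt_m)).
    by apply: val_inj; rewrite /= modn_small.
  apply: lin_equiv_trans (lin_equiv_rotation _) _; rewrite cls_rot //.
  by apply: lin_equivD (lin_equiv_refl _); apply: IHm.
case: v => [[m lt_m] j]; apply: (in_cycle) => {j}.
elim: m lt_m => [|m IHm] lt_m.
  rewrite (_ : Ordinal lt_m = ord0); last exact: val_inj.
  rewrite /cls /standard_class big1 ?addr0 => [|i _]; first exact: lin_equiv_refl.
  by rewrite pos_base.
have lt_b : (m < g.+1.-1)%N by rewrite -ltnS.
have bE : Ordinal lt_m = bridge_tgt (Ordinal lt_b) by apply: val_inj.
rewrite bE; apply: lin_equiv_trans (lin_equiv_sym (lin_equiv_bridge _)) _.
rewrite /cls /standard_class.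
under eq_bigr do rewrite -pos_bridge.
have sE : bridge_src (Ordinal lt_b) = Ordinal (ltnW lt_m) by apply: val_inj.
rewrite sE; apply: in_cycle; exact: IHm.
Qed.

Lemma divisor_class D :
  lin_equiv D (base_chip *~ deg D + standard_class (moment^~ D)).
Proof.
rewrite [D in lin_equiv D _]chip_decomposition.
have -> : base_chip *~ deg D + standard_class (moment^~ D) =
    \sum_v (base_chip + standard_class (fun i => (pos i v)%:Z)) *~ D v.
  under [RHS]eq_bigr do rewrite mulrzDl.
  rewrite big_split /= /deg mulrz_sumr; congr (_ + _).
  rewrite /standard_class; under [RHS]eq_bigr do rewrite mulrz_suml.
  rewrite exchange_big /=; apply: eq_bigr => i _; rewrite mulrz_sumr.
  by apply: eq_bigr => v _; rewrite -mulrzA mulrC.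
by apply: lin_equiv_sum => v; apply: lin_equivMz; apply: chip_class.
Qed.

(** Rotating one chip from each position of the cycle only permutes these chips. *)
Lemma rotation_torsion i : lin_equiv (rotation i *~ size i) 0.
Proof.
have -> : rotation i *~ size i = \sum_(j : 'I_(size i)) rotation i.
  by rewrite sumr_const card_ord.
rewrite -[X in lin_equiv _ X](sum_ordS (fun j : 'I_(size i) => - chip (cvert j))).
apply: lin_equiv_sum => j; rewrite opprK addrC; apply: lin_equiv_sym.
have := lin_equiv_subr (chip (cvert j)) (lin_equiv_rotation j).
by rewrite [chip _ + rotation i]addrC addrK.
Qed.

Lemma lin_equiv_of_moment D E :
    deg D = deg E ->
    (forall i, (size i %| moment i D - moment i E)%Z) ->
  lin_equiv D E.
Proof.
move=> degDE invDE; apply: lin_equiv_trans (divisor_class D) _.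
apply: lin_equiv_trans (lin_equiv_sym (divisor_class E)).
rewrite degDE; apply: lin_equivD (lin_equiv_refl _) _; apply: lin_equiv_sum => i.
have /dvdzP[q qE] := invDE i.
rewrite -[moment i D](subrK (moment i E)) qE addrC mulrC mulrzDr mulrzA.
rewrite -[X in lin_equiv _ X]addr0.
apply: lin_equivD (lin_equiv_refl _) _; rewrite -(mul0rz _ q).
exact: lin_equivMz (rotation_torsion i).
Qed.

Lemma moment_rotation i l : moment i (rotation l) = (i == l)%:Z.
Proof.
rewrite raddfB /= !moment_chip.
have [<-|nil] := eqVneq i l; last first.
  by rewrite (pos_same_cycle _ (first_vertex C l)) 1?eq_sym // subrr.
by rewrite !pos_tag /= modn_small ?subr0 // cycle_size_gt1.
Qed.

Lemma exists_divisor_of_class (d : int) (xi : 'I_g.+1 -> int) :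
  exists D, deg D = d /\ forall i, moment i D = xi i.
Proof.
exists (base_chip *~ d + standard_class xi); split.
  rewrite raddfD raddfMz /= deg_chip intz raddf_sum /= big1 ?addr0 // => i _.
  by rewrite raddfMz raddfB /= !deg_chip subrr mul0rz.
move=> i; rewrite raddfD raddfMz /= moment_chip raddf_sum /=.
rewrite pos_base mul0rz add0r (bigD1 i) //= big1 => [|l nli].
  by rewrite raddfMz /= moment_rotation eqxx addr0 intz.
by rewrite raddfMz /= moment_rotation eq_sym (negbTE nli) mul0rz.
Qed.

(** * Pushing chips to the right, and effectivity *)

Definition lucky D (m : nat) (k : int) : bool :=
  if insub m is Some i then (size i %| moment i D - k * attach C i)%Z else false.

Lemma luckyE D i k : lucky D i k = (size i %| moment i D - k * attach C i)%Z.
Proof. by rewrite /lucky valK. Qed.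

Lemma lucky_ord D m k (lt_m : (m < g.+1)%N) :
  lucky D m k =
  (size (Ordinal lt_m) %| moment (Ordinal lt_m) D - k * attach C (Ordinal lt_m))%Z.
Proof. exact: (luckyE D (Ordinal lt_m)). Qed.

(** The number of chips arriving at cycle [m], a debt if negative. The recursion is why [lucky]
    takes a natural number; its default [false] is never consulted as long as [m <= g.+1]. *)
Fixpoint carry D (m : nat) : int :=
  if m is m'.+1 then carry D m' - (~~ lucky D m' (carry D m'))%:Z else deg D.

Definition tail D (m : nat) : int := \sum_(v : V | (m <= tag v)%N) D v.

Lemma lucky_lin_equiv D E m k : lin_equiv D E -> lucky D m k = lucky E m k.
Proof.
move=> DE; rewrite /lucky; case: insubP => // i _ _.
have -> : moment i D - k * attach C i =
  (moment i D - moment i E) + (moment i E - k * attach C i) by lia.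
by rewrite rpredDl ?lin_equiv_moment.
Qed.

Lemma carry_lin_equiv D E m : lin_equiv D E -> carry D m = carry E m.
Proof.
move=> DE; elim: m => [|m /= ->]; first exact: lin_equiv_deg.
by rewrite (lucky_lin_equiv _ _ DE).
Qed.

Lemma carry_le D m : carry D m.+1 <= carry D m.
Proof. by rewrite /=; lia. Qed.

Lemma tail0 D : tail D 0 = deg D. Proof. by []. Qed.

Lemma tailS D (i : 'I_g.+1) : tail D i = tail D i.+1 + \sum_(v : V | tag v == i) D v.
Proof.
rewrite /tail (bigID (fun v => i < tag v)%N) /=; congr (_ + _).
  by apply: eq_bigl => v; rewrite andb_idl // => /ltnW.
by apply: eq_bigl => v; rewrite -leqNgt -val_eqE -eqn_leq eq_sym.
Qed.

Lemma tail_last D : tail D g.+1 = 0.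
Proof. by rewrite /tail big1 // => v; rewrite leqNgt ltn_ord. Qed.

Lemma tail_ge0 D m : effective D -> 0 <= tail D m.
Proof. by move=> /forallP D0; apply: sumr_ge0. Qed.

Lemma tail_leS D (i : 'I_g.+1) : effective D -> tail D i.+1 <= tail D i.
Proof. by move=> /forallP D0; rewrite tailS lerDl sumr_ge0. Qed.

Lemma moment_empty_cycle D i : effective D -> tail D i.+1 = tail D i ->
  moment i D = tail D i.+1 * attach C i.
Proof.
move=> /forallP D0 tailE.
have /psumr_eq0P D_i : \sum_(v : V | tag v == i) D v = 0.
  by have := tailS D i; rewrite tailE; lia.
rewrite /moment /tail mulr_suml [LHS](bigID (fun v => i < tag v)%N) /=.
rewrite [X in _ + X]big1 ?addr0 => [|v].
  by apply: eq_bigr => v /pos_gt ->.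
rewrite -leqNgt leq_eqVlt => /predU1P[/val_inj iv|lt_vi].
  by rewrite D_i ?mul0r // iv.
by rewrite pos_lt // mulr0.
Qed.

(** The carry drops by at most one per cycle, so the bound could fail only if it is an equality at
    cycle [m] and no chip of [D] lies there. The moment is then the carry times [attach], and the
    cycle is lucky. *)
Lemma tail_le_carry D m : effective D -> (m <= g.+1)%N -> tail D m <= carry D m.
Proof.
move=> D0; elim: m => [//|m IHm] lt_m; have {IHm} := IHm (ltnW lt_m).
pose i := Ordinal lt_m; have := tail_leS i D0; rewrite /= => le_tail le_carry.
have [tailE|?] := eqVneq (tail D m.+1) (tail D m); last by lia.
have [carryE|?] := eqVneq (tail D m) (carry D m); last by lia.
rewrite -carryE lucky_ord (moment_empty_cycle (i := i) D0 tailE) tailE.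
by rewrite subrr dvdz0 subr0.
Qed.

Lemma effective_carry D : equiv_effective D -> 0 <= carry D g.+1.
Proof.
case=> E DE E0; rewrite (carry_lin_equiv _ DE).
by rewrite (le_trans _ (tail_le_carry E0 (leqnn _))) ?tail_last.
Qed.

Definition unlucky D (m : nat) : nat := ~~ lucky D m (carry D m).

Lemma sum_unlucky D m : (m <= g.+1)%N ->
  \sum_(i < g.+1 | (m <= i)%N) (unlucky D i)%:Z = carry D m - carry D g.+1.
Proof.
move=> le_m; rewrite -(big_mkord (fun n => m <= n)%N (fun n => (unlucky D n)%:Z)).
rewrite -[X in X = _](big_nat_widenl _ _ _ predT) //=.
have -> : carry D m - carry D g.+1 = - carry D g.+1 - - carry D m by lia.
rewrite -(telescope_sumr (fun n => - carry D n)) //.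
by apply: eq_bigr => n _; rewrite /unlucky /=; lia.
Qed.

Definition last_vertex : V := cvert (attach C ord_max).

Lemma pos_last l : pos l last_vertex = attach C l.
Proof.
have [->|nl] := eqVneq l ord_max; first by rewrite pos_tag.
by rewrite pos_gt //= ltn_neqAle nl -ltnS ltn_ord.
Qed.

(** An effective representative has one chip on each unlucky cycle, at the position that absorbs the
    residue once the other chips have moved on, and the final carry at the last vertex. *)
Lemma carry_effective D : 0 <= carry D g.+1 -> equiv_effective D.
Proof.
move=> c0; set c := carry D g.+1 in c0.
have exx i : exists x : 'I_(size i),
    (size i %| moment i D - (carry D i - 1) * attach C i - x%:Z)%Z.
  have n0 : (size i)%:Z != 0 by have := cycle_size_gt1 C i; lia.
  set y := moment i D - _; have := modz_ge0 y n0.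
  have := ltz_pmod y (_ : 0 < (size i)%:Z).
  have := divz_eq y (size i); set z := (y %% _)%Z; case: z => // z yE lt_z _.
  have lt_zn : (z < size i)%N by have := cycle_size_gt1 C i; lia.
  by exists (Ordinal lt_zn); apply/dvdzP; exists (y %/ size i)%Z; rewrite /= {1}yE addrK.
pose x i := xchoose (exx i).
have xP i : (size i %| moment i D - (carry D i - 1) * attach C i - (x i)%:Z)%Z.
  exact: (xchooseP (exx i)).
exists (\sum_i chip (cvert (x i)) *+ unlucky D i + chip last_vertex *+ `|c|%N);
  last first.
  rewrite effectiveD ?effective_chips //.
  apply: (big_ind (@effective G)) => [|D1 D2|i _]; last exact: effective_chips.
    exact: (effective_chips last_vertex 0).
  exact: effectiveD.
apply: lin_equiv_of_moment => [|l].
  rewrite degD deg_chips gez0_abs // raddf_sum /=.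
  under eq_bigr do rewrite deg_chips.
  by have /= -> := sum_unlucky D (leq0n _); rewrite subrK.
rewrite momentD moment_chips raddf_sum /=.
rewrite pos_last.
have sumE : \sum_(i < g.+1) moment l (chip (cvert (x i)) *+ unlucky D i) =
    (unlucky D l)%:Z * (x l)%:Z + (carry D l.+1 - c) * attach C l.
  rewrite /c -sum_unlucky // (bigD1 l) //= moment_chips pos_tag.
  congr (_ + _); rewrite mulr_suml (bigID (fun i : 'I_g.+1 => l < i)%N) /=.
  rewrite [X in _ + X]big1 ?addr0 => [|i /andP[nil]]; last first.
    rewrite -leqNgt leq_eqVlt val_eqE (negbTE nil) /= => lt_il.
    by rewrite moment_chips pos_lt // mulr0.
  apply: eq_big => [i|i /andP[_ lt_li]].
    by rewrite andb_idl // => lt_li; rewrite -val_eqE /= gtn_eqF.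
  by rewrite moment_chips pos_gt.
rewrite sumE gez0_abs //.
have := xP l; have := luckyE D l (carry D l).
rewrite /unlucky /=; case: lucky => /= [/esym H _|_ H].
  by congr (dvdz _ _) : H; lia.
by congr (dvdz _ _) : H; lia.
Qed.

End ChainClass.

(** * Rank on a chain of cycles *)

Section ChainRank.
Variables (g : nat) (C : discrete_chain g.+1).
Notation V := (chain_vertex C).
Notation G := (chain_graph C).
Notation size := (cycle_size C).
Implicit Types (i l : 'I_g.+1) (D E F : divisor G) (m u v : nat).

Lemma can_subtractP D (r : int) :
  can_subtract D r <->
  (forall E, effective E -> deg E = r -> 0 <= carry (D - E) g.+1).
Proof.
split=> canD E effE degE.
  have [D' [_ DD' effD']] := canD E effE degE.
  apply: effective_carry; exists (D' - E) => //.
  exact: lin_equiv_subr (lin_equiv_sym DD').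
have [F DF effF] := carry_effective (canD E effE degE).
exists (F + E); split; rewrite ?addrK //; first exact: effectiveD.
by rewrite -[X in lin_equiv _ X](subrK E);
  apply: lin_equivD (lin_equiv_sym DF) (lin_equiv_refl _).
Qed.

(** After [n] regular cycles, the schedule adds the cells [(u, n - u)] of an antidiagonal at the
    next one, so row [u] has at least [minn b (n - u)] cells. If [E] has chips on a cycle, [u] grows
    by at least 1 and [n] by at most 1, so the bound does not ask for a lucky cycle there. *)
Lemma can_subtract_of_schedule (s : pred nat) D (r b : nat) :
    (forall i u, ~~ s i -> (u <= r)%N -> (u <= regular_before s i)%N ->
       (regular_before s i - u < b)%N ->
       lucky D i (deg D - i%:Z + (regular_before s i)%:Z - (2 * u)%:Z)) ->
    r%:Z + g.+1%:Z <= deg D + (minn b (regular_before s g.+1 - r))%:Z ->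
  can_subtract D r%:Z.
Proof.
move=> sched deg_ge; apply/can_subtractP => E effE degE.
have tail_le_r m : (m <= g.+1)%N -> tail E m <= r%:Z.
  elim: m => [_|m IHm lt_m]; first by rewrite tail0 degE.
  exact: le_trans (tail_leS (Ordinal lt_m) effE) (IHm (ltnW lt_m)).
(* Here [u] counts the chips of [E] lying before cycle [m]. *)
suff bound m u : (m <= g.+1)%N -> u%:Z = r%:Z - tail E m ->
    deg D - r%:Z - m%:Z + (minn b (regular_before s m - u))%:Z <= carry (D - E) m.
  by have := bound g.+1 r (leqnn _); rewrite tail_last subr0 => /(_ erefl); lia.
elim: m u => [|m IHm] u lt_m uE.
  by rewrite /= degB degE /regular_before /=; lia.
pose i := Ordinal lt_m.
have [v vE] : exists v : nat, v%:Z = r%:Z - tail E m.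
  by exists `|(r%:Z - tail E m)%R|%N; have := tail_le_r _ (ltnW lt_m); lia.
have := IHm v (ltnW lt_m) vE; have := carry_le (D - E) m.
have : carry (D - E) m - 1 <= carry (D - E) m.+1 by rewrite /=; lia.
have := tail_leS i effE; rewrite regular_beforeS [nat_of_ord i]/=.
have [tailE|] := eqVneq (tail E m.+1) (tail E m); last first.
  by move: (carry _ _) (carry _ _) (tail _ _) (tail _ _) uE vE => *; case: (s m); lia.
have uv : u = v by lia.
have [sm|nsm] := boolP (s m); first by rewrite uv; lia.
have [|] := boolP ((u <= regular_before s m) &&
    (regular_before s m - u < b))%N; last first.
  by rewrite uv; lia.
case/andP=> le_un lt_b _ drop _; rewrite le_eqVlt => /predU1P[carryE|]; last first.
  by move: drop; rewrite uv; lia.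
have := sched i u nsm _ le_un lt_b; rewrite [nat_of_ord i]/=.
have le_ur : (u <= r)%N by have := tail_ge0 m.+1 effE; lia.
move=> /(_ le_ur); rewrite (lucky_ord _ _ lt_m) -/i => luck.
suff : lucky (D - E) m (carry (D - E) m).
  by move=> lk; rewrite /= lk -carryE uv; lia.
(* The [r - u] chips of [E] still ahead retract to the attaching vertex, so they shift the residue
   and the carry consistently. *)
rewrite (lucky_ord _ _ lt_m) -/i momentB.
rewrite (moment_empty_cycle (i := i) effE tailE).
congr (dvdz _ _) : luck; rewrite -carryE [nat_of_ord i]/=.
rewrite -[RHS]addrA -opprD -mulrDl; congr (_ - _ * _); lia.
Qed.

Lemma carry_eq D E m : deg D = deg E ->
  (forall l, (l < m)%N -> moment l D = moment l E) -> carry D m = carry E m.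
Proof.
move=> degDE; elim: m => //= m IHm inv_eq; rewrite IHm => [|l lt_lm]; last first.
  by rewrite inv_eq // ltnW.
rewrite /lucky; case: insubP => // i _ im.
by rewrite inv_eq // -im.
Qed.

(* The walk [u] is forbidden to use a lucky cycle that would make it meet the walk
   [u - 1]: subtracting a chip on that cycle instead, the walk [u - 1] turns
   into a walk [u] that is unlucky there. *)
Fixpoint lucky_count D m u : nat :=
  if m is m'.+1 then
    lucky_count D m' u +
    (lucky D m' (deg D - u%:Z - m'%:Z + (lucky_count D m' u)%:Z) &&
     ((u == 0) || (lucky_count D m' u < lucky_count D m' u.-1))%N)
  else 0%N.

Lemma lucky_count_step D m u :
  (lucky_count D m u <= lucky_count D m.+1 u <= (lucky_count D m u).+1)%N.
Proof.
by rewrite [lucky_count D m.+1 u]/= leq_addr -[X in (_ <= X)%N]addn1 leq_add2l leq_b1.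
Qed.

Lemma lucky_count_move D m u : (lucky_count D m u < lucky_count D m.+1 u)%N ->
  lucky D m (deg D - u%:Z - m%:Z + (lucky_count D m u)%:Z) /\
  (u = 0 \/ lucky_count D m u < lucky_count D m u.-1)%N.
Proof.
rewrite /= -[X in (X < _)%N]addn0 ltn_add2l lt0b => /andP[-> /orP[/eqP->|]].
  by split; [|left].
by split; [|right].
Qed.

Lemma lucky_count_antitone D m u v :
  (u <= v)%N -> (lucky_count D m v <= lucky_count D m u)%N.
Proof.
move=> /subnKC<-; elim: (v - u)%N => [|w IHw]; first by rewrite addn0.
rewrite addnS (leq_trans _ IHw) //; elim: (m) => // n IHn.
have := lucky_count_step D n (u + w); have := lucky_count_step D n (u + w).+1.
have := @lucky_count_move D n (u + w).+1.
case: ltnP => [_ /(_ isT)[_ []]|] //=; lia.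
Qed.

(** A row can begin only after the preceding row is nonempty, one cycle later at the earliest. *)
Lemma lucky_count_gt0 D m u : (0 < lucky_count D m u)%N -> (u < m)%N.
Proof.
elim: m u => // m IHm u count_u.
have [u0|/IHm/leqW //] := posnP (lucky_count D m u).
have [|_ [-> //|]] := @lucky_count_move D m u; first by rewrite u0.
by move=> /(leq_ltn_trans (leq0n _))/IHm; lia.
Qed.

(** Realises each walk by an actual subtraction: [F] is what has been taken before cycle [m], and
    the other [r - u] chips wait at the last vertex. A forbidden lucky cycle is avoided by switching
    to the [F] of walk [u - 1] and taking one chip on the cycle itself. *)
Lemma lucky_count_carry D (r : nat) m u : (m <= g.+1)%N -> (u <= r)%N ->
  exists F, [/\ effective F, deg F = u%:Z,
    forall l, (m <= l)%N -> moment l F = 0 &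
    carry (D - (F + chip (last_vertex C) *+ (r - u))) m =
      deg D - r%:Z - m%:Z + (lucky_count D m u)%:Z].
Proof.
elim: m u => [|m IHm] u lt_m le_ur.
  exists (base_chip C *+ u); split.
  - exact: effective_chips.
  - by rewrite deg_chips.
  - by move=> l _; rewrite moment_chips pos_base mulr0.
  rewrite /= degB degD !deg_chips; lia.
pose i := Ordinal lt_m.
pose luck := lucky D m (deg D - u%:Z - m%:Z + (lucky_count D m u)%:Z).
have [F [effF degF invF carryF]] := IHm u (ltnW lt_m) le_ur.
have [skip|noskip] := boolP
    (luck && ~~ ((u == 0) || (lucky_count D m u < lucky_count D m u.-1))%N); last first.
  exists F; split=> // [l lt_ml|]; first exact: invF (ltnW lt_ml).
  rewrite [LHS]/= carryF.
  have -> : lucky (D - (F + chip (last_vertex C) *+ (r - u))) m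
      (deg D - r%:Z - m%:Z + (lucky_count D m u)%:Z) = luck.
    rewrite /luck !(lucky_ord _ _ lt_m) -/i momentB momentD.
    rewrite invF // add0r moment_chips pos_last.
    have -> : deg D - u%:Z - m%:Z + (lucky_count D m u)%:Z =
        (r - u)%N%:Z + (deg D - r%:Z - m%:Z + (lucky_count D m u)%:Z) by lia.
    by rewrite [in RHS]mulrDl opprD addrA.
  move: noskip; rewrite [lucky_count D m.+1 u]/= -/luck.
  by case: luck => /=; [case: (_ || _)|]; lia.
case/andP: skip => luckT; rewrite negb_or -leqNgt => /andP[u0 count_le].
have [v uE] : exists v, u = v.+1 by exists u.-1; rewrite prednK // lt0n.
have {count_le} countE : lucky_count D m u = lucky_count D m v.
  by have := lucky_count_antitone D m (leqnSn v); move: count_le; rewrite uE /=; lia.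
have [|{}F [{}effF {}degF {}invF {}carryF]] := IHm v (ltnW lt_m); first by lia.
(* Position 1 changes the residue by exactly 1, which spoils luck because the cycle has size at
   least 2. *)
pose w : V := cvert (ordS (first_vertex C i)).
exists (F + chip w); split.
- by rewrite effectiveD // (effective_chips w 1).
- by rewrite degD degF deg_chip uE; lia.
- move=> l lt_ml; rewrite momentD invF ?(ltnW lt_ml) // moment_chip.
  by rewrite pos_lt.
set D' := D - (F + chip w + _).
have carryD' : carry D' m = deg D - r%:Z - m%:Z + (lucky_count D m v)%:Z.
  rewrite -carryF; apply: carry_eq => [|l lt_lm].
    rewrite !degB !degD !deg_chips deg_chip; lia.
  rewrite !momentB !momentD !moment_chips moment_chip pos_last pos_gt //.
  have -> : (r - v)%N = (r - u).+1 by lia.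
  lia.
rewrite [LHS]/= carryD' [lucky_count D m.+1 u]/= -/luck luckT.
have -> : lucky D' m (deg D - r%:Z - m%:Z + (lucky_count D m v)%:Z) = false.
  apply/negbTE; apply/negP.
  rewrite (lucky_ord _ _ lt_m) -/i => unluck.
  have n1 := cycle_size_gt1 C i.
  move: luckT; rewrite /luck (lucky_ord _ _ lt_m) -/i => luck_i.
  suff : (size i %| 1)%Z by rewrite dvdzE /= dvdn1; lia.
  have := rpredB luck_i unluck; congr (is_true (dvdz _ _)).
  rewrite /D' momentB !momentD invF // moment_chip moment_chips pos_last pos_tag.
  rewrite /= modn_small // countE -subzn //; lia.
rewrite countE uE ltnn /=; lia.
Qed.

Lemma lucky_count_ge D (r : nat) u : can_subtract D r%:Z -> (u <= r)%N ->
  r%:Z + g.+1%:Z - deg D <= (lucky_count D g.+1 u)%:Z.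
Proof.
move=> /can_subtractP canD le_ur.
have [F [effF degF _ carryF]] := lucky_count_carry D (leqnn _) le_ur.
have := canD (F + chip (last_vertex C) *+ (r - u)).
rewrite effectiveD ?effective_chips // degD deg_chips degF carryF.
by move=> /(_ isT); lia.
Qed.

Lemma dvdn_profile i : (size i %| profile C i * attach C i)%N.
Proof. by rewrite /profile; case: ex_minnP => m /andP[]. Qed.

(** The profile is the additive order of [attach C i] modulo [size i]. *)
Lemma profile_dvd i (z : int) :
  (size i %| z * attach C i)%Z -> (profile C i %| z)%Z.
Proof.
rewrite !dvdzE abszM /= /profile; case: ex_minnP => m /andP[m0 dvd_m] min_m dvd_z.
rewrite /dvdn; case: posnP => // q0.
have dvd_q : (size i %| (`|z| %% m) * attach C i)%N.
  move: dvd_z; rewrite {1}(divn_eq `|z| m) mulnDl dvdn_addr //.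
  by rewrite -mulnA dvdn_mull.
have lt_q := ltn_pmod `|z| m0.
by have := min_m (`|z| %% m)%N; rewrite q0 dvd_q => /(_ isT); rewrite leqNgt lt_q.
Qed.

End ChainRank.

(** * Martens-special chains *)

Lemma sorted_gap2_ltn (j : seq nat) :
  sorted (fun a b => a + 2 <= b)%N j -> sorted ltn j.
Proof. by apply: sub_sorted => a b /=; lia. Qed.

Lemma sorted_gap2_sparse (j : seq nat) a :
  sorted (fun a b => a + 2 <= b)%N j -> a \in j -> a.+1 \notin j.
Proof.
move=> sj aj; apply/negP => bj.
have tr : transitive (fun a b => a + 2 <= b)%N by move=> x y z /=; lia.
have ia := index_mem a j; have ib := index_mem a.+1 j.
have := sorted_ltn_nth tr 0%N sj; rewrite aj in ia; rewrite bj in ib.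
move=> nth_le; have := nth_le (index a j) (index a.+1 j) ia ib.
have := nth_le (index a.+1 j) (index a j) ib ia; rewrite !nth_index //.
case: ltngtP => //; [by move=> _ /(_ isT); lia | by move=> _ _ /(_ isT); lia|].
move=> ix; have := nth_index 0%N aj; rewrite -ix nth_index //; lia.
Qed.

Lemma count_succ_mem (j : seq nat) n :
  uniq j -> {in j, forall a, 0 < a <= n}%N ->
  count (fun m => m.+1 \in j) (iota 0 n) = size j.
Proof.
move=> uj j_le; rewrite -(count_map S (mem j)) -size_filter.
apply/perm_size/uniq_perm => // [|a].
  by rewrite filter_uniq // (map_inj_uniq succn_inj) iota_uniq.
rewrite mem_filter; apply: andb_idr => /j_le /andP[a0 le_an].
by apply/mapP; exists a.-1; rewrite ?mem_iota ?prednK //; lia.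
Qed.

Section Martens.
Variables (k g : nat) (C : discrete_chain g.+1) (j : k.-tuple nat).
Notation G := (chain_graph C).
Notation size := (cycle_size C).
Hypothesis k_gt0 : (0 < k)%N.
Hypothesis j_range : all (fun a => 3 <= a <= g.+1 - 2)%N j.
Hypothesis j_gap : sorted (fun a b => a + 2 <= b)%N j.
Hypothesis profile2 : forall i : 'I_g.+1,
  (2 <= i.+1 <= g.+1 - 1)%N -> i.+1 \notin j -> profile C i = 2%N.
Hypothesis profile_gt : forall i : 'I_g.+1, i.+1 \in j -> (g.+1 < profile C i)%N.

Let special m := m.+1 \in j.

Lemma uniq_special : uniq j.
Proof. exact: sorted_uniq ltn_trans ltnn _ (sorted_gap2_ltn j_gap). Qed.

Lemma special_bounds m : special m -> (2 <= m /\ m.+3 <= g.+1)%N.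
Proof. by move=> /(allP j_range); lia. Qed.

Lemma special0 : ~~ special 0.
Proof. by apply/negP => /special_bounds; lia. Qed.

Lemma special_last : ~~ special g.
Proof. by apply/negP => /special_bounds; lia. Qed.

Lemma special_room : (k + 3 <= g)%N.
Proof.
have sub : {subset j <= iota 3 (g - 3)}.
  by move=> a /(allP j_range); rewrite mem_iota; lia.
have := uniq_leq_size uniq_special sub; rewrite size_tuple size_iota; lia.
Qed.

Lemma regular_before_special : regular_before special g.+1 = (g.+1 - k)%N.
Proof.
rewrite /regular_before; have := count_predC special (iota 0 g.+1).
rewrite count_succ_mem ?uniq_special // => [|a /(allP j_range)]; last by lia.
by rewrite size_iota size_tuple; lia.
Qed.

(** For the carries of two walks at the same cycle, [x - y] is the difference of the contents of
    their next cells. *)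
Lemma lucky_profile (D : divisor G) m x y (lt_m : (m < g.+1)%N) :
  lucky D m x -> lucky D m y -> (profile C (Ordinal lt_m) %| x - y)%Z.
Proof.
rewrite !(lucky_ord _ _ lt_m) => lx ly; apply: profile_dvd.
have := rpredB ly lx; congr (is_true (dvdz _ _)).
rewrite mulrBl; lia.
Qed.

Lemma deg_ge_of_can_subtract (D : divisor G) (r : nat) :
  (1 <= r <= g.+1 - k - 1)%N -> can_subtract D r%:Z -> k%:Z + 2 * r%:Z <= deg D.
Proof.
move=> /andP[r0 le_r] canD; rewrite leNgt; apply/negP => lt_deg.
(* A degree below [k + 2 * r] forces all rows to reach this length. Since [r + b] is one more than
   the number of regular cycles, [growth_bound] is contradicted. Below, [P] cuts the rows at [b]. *)
pose b := (g.+1 - k + 1 - r)%N.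
have countP u : (u <= r)%N -> (b <= lucky_count D g.+1 u)%N.
  by move=> le_ur; have := lucky_count_ge canD le_ur; rewrite /b; lia.
pose P m u := minn b (lucky_count D m u).
have moveP m u : (P m u < P m.+1 u)%N ->
    [/\ (P m u < b)%N, P m u = lucky_count D m u &
        (lucky_count D m u < lucky_count D m.+1 u)%N].
    by rewrite /P => lt_P; split; lia.
suff : (r + b <= regular_before special g.+1)%N.
  by rewrite regular_before_special /b; lia.
apply: (@growth_bound special _ P).
- by move=> m; apply: sorted_gap2_sparse j_gap.
- exact: r0.
- by rewrite /b; lia.
- exact: special0.
- exact: special_last.
- by move=> u; rewrite /P minn0.
- by move=> u /countP; rewrite /P; lia.
- by move=> m u; have := lucky_count_step D m u; rewrite /P; lia.
- move=> m u /moveP[lt_b PE /lucky_count_move[_ [//|]]].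
  by rewrite /P /= in lt_b PE *; lia.
- move=> m u v /andP[m0 lt_mg] nsm le_ur le_vr /moveP[_ -> /lucky_count_move[lu _]].
  move=> /moveP[_ -> /lucky_count_move[lv _]].
  have lt_m : (m < g.+1)%N by lia.
  have := lucky_profile lt_m lu lv; rewrite profile2 //=; last by lia.
  move=> /dvdzP[q]; lia.
(* Contents in the rectangle differ by at most [g.+1 - k], less than the profile, so the two
   contents are equal. Antitone row lengths then force the rows to coincide. *)
- move=> m u v lt_m sm le_ur le_vr /moveP[lt_u uE /lucky_count_move[lu _]].
  move=> /moveP[lt_v vE /lucky_count_move[lv _]].
  have := lucky_profile lt_m lu lv; rewrite dvdzE /= => dvd.
  have := @profile_gt (Ordinal lt_m) sm; have := dvdn_leq _ dvd.
  have := @lucky_count_antitone _ _ D m u v; have := @lucky_count_antitone _ _ D m v u.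
  rewrite uE vE /b in lt_u lt_v *; lia.
Qed.

Lemma exists_scheduled_divisor (r : nat) :
  (1 <= r <= g.+1 - k - 1)%N ->
  exists2 D : divisor G, deg D = k%:Z + 2 * r%:Z & can_subtract D r%:Z.
Proof.
move=> /andP[r0 le_r]; pose n m := regular_before special m.
pose d : int := k%:Z + 2 * r%:Z.
(* The schedule asks for luck at [d - i + n i - 2 * u]. Where the profile is 2, the term [2 * u]
   does not matter. The end cycles have no prescribed profile, but only [u = 0] is required at the
   first and only [u = r] at the last. *)
pose xi (i : 'I_g.+1) : int :=
  (d - i%:Z + (n i)%:Z - (if i == ord_max then 2 * r else 0)%N%:Z) * attach C i.
have [D [degD momD]] := exists_divisor_of_class C d xi.
exists D => //; apply: (@can_subtract_of_schedule _ _ special _ _ (g.+1 - k - r)).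
  move=> i u nsi le_ur le_un lt_b; rewrite luckyE momD /xi degD -/(n i) -mulrBl.
  have n_g : n g = (g - k)%N.
    have := regular_before_special; rewrite regular_beforeS special_last /n; lia.
  have [iE|ni] := eqVneq i ord_max.
    have -> : u = r by move: lt_b le_un; rewrite -/(n i) iE /= n_g; lia.
    by rewrite [X in X * _](_ : _ = 0) ?mul0r ?dvdz0 //; lia.
  have [i0|i0] := posnP i.
    have -> : u = 0%N by move: le_un; rewrite i0 /regular_before /=; lia.
    by rewrite [X in X * _](_ : _ = 0) ?mul0r ?dvdz0 //; lia.
  have lt_ig : (i < g)%N.
    by move: ni; rewrite -val_eqE /=; have := ltn_ord i; lia.
  have /dvdnP[q qE] := dvdn_profile C i; rewrite profile2 //= in qE; last by lia.
  apply/dvdzP; exists (u%:Z * q%:Z); rewrite -mulrA -PoszM -qE PoszM; lia.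
rewrite degD regular_before_special /d; lia.
Qed.

End Martens.

Section AnyChain.
Variables (g : nat) (C : discrete_chain g.+1).
Notation G := (chain_graph C).

(** A rectangle with a single column suffices: cell [u] is added at cycle [u], so each cycle has to
    be lucky for one row only and its profile is irrelevant. *)
Lemma exists_divisor_deg_add_genus_pred (r : nat) : (r <= g)%N ->
  exists2 D : divisor G, deg D = r%:Z + g%:Z & can_subtract D r%:Z.
Proof.
move=> le_rg; have [D [degD momD]] := exists_divisor_of_class C (r%:Z + g%:Z)
  (fun i => (r%:Z + g%:Z - (2 * i)%N%:Z) * attach C i).
have before m : regular_before pred0 m = m.
  by rewrite /regular_before (eq_count (a2 := predT)) // count_predT size_iota.
exists D => //; apply: (@can_subtract_of_schedule _ _ pred0 _ _ 1).
  move=> i u _ _; rewrite before => le_ui lt_1.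
  have -> : u = i by lia.
  rewrite luckyE momD degD; set x := _ * _; set y := _ * _.
  by rewrite (_ : x - y = 0) ?dvdz0 // /x /y; lia.
by rewrite degD before; lia.
Qed.

Lemma can_subtract_large_deg (D : divisor G) (r : nat) :
  r%:Z + g.+1%:Z <= deg D -> can_subtract D r%:Z.
Proof.
move=> deg_ge; apply: (@can_subtract_of_schedule _ _ predT _ _ 0) => //.
by rewrite min0n addr0.
Qed.

(** Row [r] is still empty after all [g.+1] cycles, so walk [r] loses a chip at each of them. *)
Lemma deg_ge_of_can_subtract_large (D : divisor G) (r : nat) :
  (g < r)%N -> can_subtract D r%:Z -> r%:Z + g.+1%:Z <= deg D.
Proof.
move=> lt_gr canD; rewrite leNgt; apply/negP => lt_deg.
have := lucky_count_ge canD (leqnn r) => count_r.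
have := @lucky_count_gt0 _ _ D g.+1 r; lia.
Qed.

End AnyChain.

Theorem theoremC (k g : nat) (C : discrete_chain g)
    (hk : (1 <= k)%N) (hC : general_martens_special C k) :
  [/\ forall r : nat, (1 <= r <= g - k - 1)%N ->
        is_gonality (chain_graph C) r (k%:Z + 2 * r%:Z),
      forall r : nat, (g - k <= r <= g - 1)%N ->
        is_gonality (chain_graph C) r (r%:Z + g%:Z - 1) &
      forall r : nat, (g <= r)%N ->
        is_gonality (chain_graph C) r (r%:Z + g%:Z)].
Proof.
have g0 : (0 < g)%N.
  case: hC => j [/allP j_range _ _ _].
  by have := j_range _ (mem_nth 0%N (_ : (0 < size j)%N)); rewrite size_tuple; lia.
case: g g0 C hC => // g _ C [j [j_range j_gap profile2 profile_gt]].
have lt_kg := special_room hk j_range j_gap.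
have v0 := last_vertex C.
have gonalityE r n :
    (exists2 D : divisor (chain_graph C), deg D = n & can_subtract D r%:Z) ->
    (forall D : divisor (chain_graph C), can_subtract D r%:Z -> n <= deg D) ->
  is_gonality (chain_graph C) r n.
  move=> [D degD canD] lower; split; first by exists D; rewrite ?(rank_geP _ _ v0).
  by move=> E /(rank_geP _ _ v0); apply: lower.
split=> r hr; apply: gonalityE.
- exact: exists_scheduled_divisor hk j_range j_gap profile2 _ hr.
- by move=> D; apply: deg_ge_of_can_subtract hk j_range j_gap profile2 profile_gt _ _ hr.
- rewrite (_ : _ - 1 = r%:Z + g%:Z); last by lia.
  by apply: exists_divisor_deg_add_genus_pred; lia.
(* The genus is now [g.+1], so [r0] is the last index of the first range. Removing [r - r0] chips
   reduces to it. *)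
- move=> D canD; pose r0 := (g - k)%N; have rE : r = (r0 + (r - r0))%N by lia.
  rewrite rE in canD; have /= := can_subtract_chips v0 canD.
  move/(deg_ge_of_can_subtract hk j_range j_gap profile2 profile_gt).
  by rewrite degB deg_chips /r0; lia.
- have [D [degD _]] := exists_divisor_of_class C (r%:Z + g.+1%:Z) (fun=> 0).
  by exists D => //; apply: can_subtract_large_deg; rewrite degD.
- by move=> D; apply: deg_ge_of_can_subtract_large.
Qed.
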